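(* Let $f_1,\dots,f_n:\mathbb{R}^d\to\mathbb{R}$ be differentiable and convex, and let $f=\frac1n\sum_{i=1}^nf_i$. Suppose that $f$ and $f_1,\dots,f_n$ are all $L$-smooth and that $f$ has a minimizer $x_\ast\in\mathbb{R}^d$. Let $\sigma_\ast^2=\frac1n\sum_{i=1}^n\|\nabla f_i(x_\ast)\|^2$. Run Random Reshuffling or Shuffle-Once for $T\ge1$ epochs from $x_0\in\mathbb{R}^d$ with the stepsize $$\gamma=\min\left\{\frac{1}{\sqrt2\,Ln},\ \left(\frac{\|x_0-x_\ast\|^2}{Ln^2T\sigma_\ast^2}\right)^{1/3}\right\}.$$ Then the average iterate $\hat x_T=\frac1T\sum_{j=1}^Tx_j$ satisfies $$\mathbb{E}\left[f(\hat x_T)-f(x_\ast)\right]\le\frac{L\|x_0-x_\ast\|^2}{\sqrt2\,T}+\frac{3L^{1/3}\|x_0-x_\ast\|^{4/3}\sigma_\ast^{2/3}}{4n^{1/3}T^{2/3}}.$$ Moreover, for $\varepsilon>0$, $\mathbb{E}[f(\hat x_T)-f(x_\ast)]\le\varepsilon^2$ is guaranteed provided that the total number of iterations satisfies $$Tn\ge\frac{2\|x_0-x_\ast\|^2\sqrt{Ln}}{\varepsilon^2}\max\left\{\sqrt{2Ln},\frac{\sigma_\ast}{\varepsilon}\right\}.$$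
   Context: $L$-smooth means that the gradient is $L$-Lipschitz. If $\sigma_\ast=0$, the second term in the minimum defining $\gamma$ is read as $+\infty$. Algorithms. Both algorithms take a stepsize $\gamma>0$, a starting point $x_0\in\mathbb{R}^d$ and a number of epochs $T$. Random Reshuffling (RR): in each epoch $t=0,1,\dots,T-1$, sample afresh (independently) a uniformly random permutation $\pi=(\pi_0,\pi_1,\dots,\pi_{n-1})$ of $\{1,\dots,n\}$, set $x_t^0=x_t$, perform $x_t^{i+1}=x_t^i-\gamma\nabla f_{\pi_i}(x_t^i)$ for $i=0,1,\dots,n-1$, and set $x_{t+1}=x_t^n$. Shuffle-Once (SO): identical, except that a single uniformly random permutation $\pi$ is sampled once before the first epoch and is used in all epochs. The expectation is over the random permutations. *)

(* Defs.v *)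
From HB Require Import structures.
From mathcomp Require Import all_boot all_order all_algebra fingroup perm.
From mathcomp Require Import all_classical all_reals all_analysis.

Set Implicit Arguments.
Unset Strict Implicit.
Unset Printing Implicit Defensive.

Import Order.TTheory GRing.Theory Num.Theory.
Import numFieldNormedType.Exports.

Local Open Scope classical_set_scope.
Local Open Scope ring_scope.

(* The library norm `|x| on 'rV[R]_d is the sup norm, so the Euclidean norm is
   defined here. Differentiability does not depend on the choice of norm. *)
Definition enorm (R : realType) (d : nat) (x : 'rV[R]_d) : R :=
  Num.sqrt (\sum_(j < d) x 0 j ^+ 2).

Definition gradient (R : realType) (d : nat) (f : 'rV[R]_d -> R)
    (x : 'rV[R]_d) : 'rV[R]_d :=
  \row_(j < d) ('d (f : 'rV[R]_d -> R^o) x (delta_mx 0 j) : R).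

Definition differentiable_everywhere (R : realType) (d : nat)
    (f : 'rV[R]_d -> R) : Prop :=
  forall x : 'rV[R]_d, differentiable (f : 'rV[R]_d -> R^o) x.

Definition smooth (R : realType) (d : nat) (L : R) (f : 'rV[R]_d -> R) : Prop :=
  forall x y : 'rV[R]_d,
    enorm (gradient f x - gradient f y) <= L * enorm (x - y).

Definition convex_on_space (R : realType) (d : nat) (f : 'rV[R]_d -> R) : Prop :=
  @convex_function R 'rV[R]_d setT f.

Definition minimizer (R : realType) (d : nat) (f : 'rV[R]_d -> R)
    (x : 'rV[R]_d) : Prop :=
  forall y : 'rV[R]_d, f x <= f y.

Section FiniteSum.
Context (R : realType) (d n : nat) (f_ : 'I_n -> 'rV[R]_d -> R).

Definition objective (x : 'rV[R]_d) : R := n%:R^-1 * \sum_(i < n) f_ i x.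

Definition sigma_star (xs : 'rV[R]_d) : R :=
  Num.sqrt (n%:R^-1 * \sum_(i < n) enorm (gradient (f_ i) xs) ^+ 2).

(* When sigma_* = 0 the second term of the minimum stands for +oo, whereas the
   library convention 1 / 0 = 0 would make it 0; hence the case split. *)
Definition stepsize (L : R) (T : nat) (x0 xs : 'rV[R]_d) : R :=
  let a := 1 / (Num.sqrt 2 * L * n%:R) in
  let s := sigma_star xs in
  if s == 0 then a
  else Num.min a
    ((enorm (x0 - xs) ^+ 2 / (L * n%:R ^+ 2 * T%:R * s ^+ 2)) `^ (1 / 3)).

(* enum 'I_n lists 0, ..., n-1 in increasing order, so the component functions
   are visited in the order p 0, p 1, ..., p (n-1). *)
Definition epoch (gamma : R) (p : 'S_n) (x : 'rV[R]_d) : 'rV[R]_d :=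
  foldl (fun y i => y - gamma *: gradient (f_ (p i)) y) x (enum 'I_n).

Fixpoint iterate (gamma : R) (perms : nat -> 'S_n) (x0 : 'rV[R]_d) (t : nat) :
    'rV[R]_d :=
  if t is t'.+1 then epoch gamma (perms t') (iterate gamma perms x0 t')
  else x0.

Definition average_iterate (gamma : R) (perms : nat -> 'S_n) (x0 : 'rV[R]_d)
    (T : nat) : 'rV[R]_d :=
  T%:R^-1 *: \sum_(1 <= j < T.+1) iterate gamma perms x0 j.

End FiniteSum.

Section RandomPermutations.
Context (R : realType) (disp : measure_display) (Omega : measurableType disp).
Context (P : probability Omega R) (n : nat).

Definition uniform_perm (p : Omega -> 'S_n) : Prop :=
  forall s : 'S_n,
    measurable (p @^-1` [set s]) /\
    P (p @^-1` [set s]) = ((n`!%:R : R)^-1)%:E.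

Definition independent_perms (T : nat) (perms : nat -> Omega -> 'S_n) : Prop :=
  forall (J : {set 'I_T}) (A : 'I_T -> set 'S_n),
    P (\bigcap_(t in [set` J]) (perms t @^-1` A t)) =
    (\prod_(t in J) P (perms t @^-1` A t))%E.

(* perms t is the permutation used in epoch t; only epochs t < T matter. *)
Definition random_reshuffling (T : nat) (perms : nat -> Omega -> 'S_n) : Prop :=
  (forall t, (t < T)%N -> uniform_perm (perms t)) /\ independent_perms T perms.

Definition shuffle_once (T : nat) (perms : nat -> Omega -> 'S_n) : Prop :=
  exists p : Omega -> 'S_n,
    uniform_perm p /\ forall t w, (t < T)%N -> perms t w = p w.

End RandomPermutations.

(* Main.v *)
(* One epoch is read backwards: with g_i the gradient used at the inner iterate
   x^i, and x^n the end of the epoch, expanding |x^0 - x_*|^2 around x^n and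
   applying a three-point inequality to each <g_i, x^n - x_*> leaves the errors
   |x^n - x^i|^2. Splitting g_i at the gradient taken at x_*, the co-coercivity
   terms absorb one part of these errors as soon as 2 (gamma L n)^2 <= 1, and
   what remains depends on the permutation only through the partial sums of the
   component gradients at x_*. These sum to zero, so sampling without
   replacement makes the mean square of a sum of m of them m (n - m) / (n - 1)
   times the mean square of one. The descent is pathwise, so only the uniform
   law of each single permutation matters and both sampling schemes are
   treated at once. *)
Require Import Defs.
From mathcomp Require Import all_boot all_order all_algebra fingroup perm.
From mathcomp Require Import all_classical all_reals all_analysis.
From mathcomp Require Import measurable_realfun.
From mathcomp Require Import ring lra zify.
Import Order.TTheory GRing.Theory Num.Theory.
Import numFieldNormedType.Exports.
Local Open Scope classical_set_scope.
Local Open Scope ring_scope.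

Set Implicit Arguments.
Unset Strict Implicit.
Unset Printing Implicit Defensive.

(** * Smooth convex functions *)

Section Euclidean.
Context (R : realType) (d : nat).
Implicit Types x y z : 'rV[R]_d.

Definition dot x y : R := \sum_(j < d) x 0 j * y 0 j.

Lemma dotC x y : dot x y = dot y x.
Proof. by apply: eq_bigr => j _; rewrite mulrC. Qed.

Lemma dotDl x y z : dot (x + y) z = dot x z + dot y z.
Proof. by rewrite -big_split; apply: eq_bigr => j _; rewrite !mxE mulrDl. Qed.

Lemma dotZl a x z : dot (a *: x) z = a * dot x z.
Proof. by rewrite mulr_sumr; apply: eq_bigr => j _; rewrite !mxE mulrA. Qed.

Lemma dotDr x y z : dot z (x + y) = dot z x + dot z y.
Proof. by rewrite dotC dotDl !(dotC z). Qed.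

Lemma dotZr a x z : dot z (a *: x) = a * dot z x.
Proof. by rewrite dotC dotZl dotC. Qed.

Lemma dotNl x z : dot (- x) z = - dot x z.
Proof. by rewrite -scaleN1r dotZl mulN1r. Qed.

Lemma dotNr x z : dot z (- x) = - dot z x.
Proof. by rewrite dotC dotNl dotC. Qed.

Lemma dot0l z : dot 0 z = 0.
Proof. by rewrite -(scale0r 0) dotZl mul0r. Qed.

Lemma dot_suml (I : Type) (r : seq I) (P : pred I) (u : I -> 'rV[R]_d) z :
  dot (\sum_(i <- r | P i) u i) z = \sum_(i <- r | P i) dot (u i) z.
Proof.
by elim/big_rec2 : _ => [|i a b _ <-]; rewrite ?dot0l ?dotDl.
Qed.

Lemma dot_sumr (I : Type) (r : seq I) (P : pred I) (u : I -> 'rV[R]_d) z :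
  dot z (\sum_(i <- r | P i) u i) = \sum_(i <- r | P i) dot z (u i).
Proof. by rewrite dotC dot_suml; apply: eq_bigr => i _; rewrite dotC. Qed.

Lemma dot_ge0 x : 0 <= dot x x.
Proof. by apply: sumr_ge0 => j _; rewrite -expr2 sqr_ge0. Qed.

Lemma dot_eq0 x : dot x x = 0 -> x = 0.
Proof.
move=> /eqP; rewrite psumr_eq0 => [/allP h|j _]; last by rewrite -expr2 sqr_ge0.
apply/rowP => j; rewrite mxE.
by have /= := h j (mem_index_enum _); rewrite mulf_eq0 orbb => /eqP.
Qed.

Lemma enorm_ge0 x : 0 <= enorm x.
Proof. exact: sqrtr_ge0. Qed.

Lemma enorm_sqr x : enorm x ^+ 2 = dot x x.
Proof.
by rewrite sqr_sqrtr ?sumr_ge0// => j _; rewrite sqr_ge0.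
Qed.

Lemma enormZ a x : enorm (a *: x) = `|a| * enorm x.
Proof.
rewrite -sqrtr_sqr -sqrtrM ?sqr_ge0// mulr_sumr; congr Num.sqrt.
by apply: eq_bigr => j _; rewrite mxE exprMn.
Qed.

Lemma dot_sub_sqr x y : dot (x - y) (x - y) = dot x x - 2 * dot x y + dot y y.
Proof. rewrite !(dotDl, dotDr, dotNl, dotNr) (dotC y x); lra. Qed.

Lemma dot_add_sqr x y : dot (x + y) (x + y) = dot x x + 2 * dot x y + dot y y.
Proof. rewrite !(dotDl, dotDr) (dotC y x); lra. Qed.

Lemma dot_le_half x y : dot x y <= (dot x x + dot y y) / 2.
Proof. have := dot_ge0 (x - y); rewrite dot_sub_sqr; lra. Qed.

Lemma dot_add_sqr_le x y : dot (x + y) (x + y) <= 2 * dot x x + 2 * dot y y.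
Proof. have := dot_le_half x y; rewrite dot_add_sqr; lra. Qed.

Lemma dot_sum_sqr_le (I : finType) (A : {pred I}) (u : I -> 'rV[R]_d) :
  dot (\sum_(i in A) u i) (\sum_(i in A) u i) <=
  #|A|%:R * \sum_(i in A) dot (u i) (u i).
Proof.
rewrite dot_suml; under eq_bigr do rewrite dot_sumr.
apply: (@le_trans _ _
    (\sum_(i in A) \sum_(j in A) (dot (u i) (u i) + dot (u j) (u j)) / 2)).
  by apply: ler_sum => i _; apply: ler_sum => j _; apply: dot_le_half.
under eq_bigr do rewrite -mulr_suml big_split sumr_const.
rewrite -mulr_suml big_split /= sumr_const -sumrMnl.
by rewrite -mulr2n -[X in X / 2]mulr_natr mulfK// sumrMnl mulr_natl.
Qed.

(** Expanding [0 <= |x - c y|^2] and inserting [|x|^2 <= c^2 |y|^2] leaves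
    [2 c <x, y> <= 2 c^2 |y|^2]. This turns a Lipschitz bound into a bound on an inner product. *)
Lemma dot_le_of_enorm x y (c : R) :
  0 < c -> enorm x <= c * enorm y -> dot x y <= c * dot y y.
Proof.
move=> c0 h.
have h2 : dot x x <= c ^+ 2 * dot y y.
  by rewrite -!enorm_sqr -exprMn ler_sqr ?nnegrE ?mulr_ge0 ?enorm_ge0 // ltW.
have := dot_ge0 (x - c *: y); rewrite dot_sub_sqr dotZr dotZl dotZr => h3.
rewrite -(ler_pM2l c0); lra.
Qed.

End Euclidean.

(** * First-order inequalities for smooth convex functions *)

Section SmoothConvex.
Context (R : realType) (d : nat) (f : 'rV[R]_d -> R).
Hypothesis f_diff : differentiable_everywhere f.
Implicit Types x y z v : 'rV[R]_d.

Lemma diff_gradient x v :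
  'd (f : 'rV[R]_d -> R^o) x v = dot (gradient f x) v.
Proof.
rewrite {1}(row_sum_delta v) linear_sum /=; apply: eq_bigr => j _.
by rewrite linearZ /= mxE mulrC.
Qed.

Lemma is_derive_line x v (s : R) :
  is_derive s 1 ((fun s => f (x + s *: v)) : R -> R^o)
    (dot (gradient f (x + s *: v)) v).
Proof.
(* The difference quotient of the restriction to the line is the directional difference quotient of
   [f] at [x + s v]. *)
have E : (fun h : R => h^-1 *: (((fun s => f (x + s *: v) : R^o) \o shift s)
             (h *: (1 : R)) - f (x + s *: v)))
    = (fun h => h^-1 *: ((f : _ -> R^o) (h *: v + (x + s *: v))
                         - f (x + s *: v))).
  apply/funext => h /=; congr (_ *: (f _ - _)).
  by rewrite scalerDl addrCA [h *: 1]mulr1.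
have D := @diff_derivable _ _ _ (f : _ -> R^o) _ v (@f_diff (x + s *: v)).
apply: DeriveDef.
  by rewrite /derivable E; exact: D.
by rewrite /derive E -diff_gradient -deriveE.
Qed.

(** For [0 < h <= 1], convexity bounds the slope of [f] from [x] to [x + h (y - x)] by [f y - f x];
    let [h] tend to 0 from the right. *)
Lemma convex_first_order x y :
  convex_on_space f -> f x + dot (gradient f x) (y - x) <= f y.
Proof.
move=> cf.
have [D H] := is_derive_line x (y - x) 0.
move: H; rewrite scale0r addr0 => H.
rewrite -lerBrDl -H.
apply: (cvgr_to_le (cvg_dnbhs_at_right D)).
near=> h.
have h0 : 0 < h by [].
have h1 : h <= 1 by near: h; apply: nbhs_right_le.
rewrite /= addr0 scale0r addr0 [h *: 1]mulr1 [_ *: _]mulrC ler_pdivrMr//.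
have := cf (Itv01 (ltW h0) h1) y x; rewrite !in_setE => /(_ I I).
rewrite convRE [conv _ _ _](_ : _ = x + h *: (y - x)).
  rewrite /= /unstable.onem => ?; lra.
by rewrite /conv /= /unstable.onem scalerBr scalerBl scale1r addrC addrA addrAC.
Unshelve. all: by end_near. Qed.

(** Mean value theorem for [p], the restriction of [f] to the segment minus the claimed quadratic
    bound (up to a constant): the Lipschitz gradient makes its derivative [q] nonpositive on []0,
    1[]. *)
Lemma smooth_upper_bound (L : R) x y : 0 < L -> smooth L f ->
  f y <= f x + dot (gradient f x) (y - x) + L / 2 * dot (y - x) (y - x).
Proof.
move=> L0 fL; set v := y - x.
have [c cE] : exists c, c = dot (gradient f x) v by eexists.
rewrite -cE.
pose q (s : R) := dot (gradient f (x + s *: v)) v - c - L * s * dot v v.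
pose p : R -> R := (fun s => f (x + s *: v) : R) \- (fun s => s * c)
                   \- (fun s => L / 2 * dot v v * s ^+ 2).
have pd (s : R) : is_derive s 1 p (q s).
  have H := is_derive_line x v s.
  apply: is_derive_eq; rewrite /q scaler0 add0r.
  rewrite [c%:A]mulr1 [s%:A]mulr1 [_ *: (s + s)]mulrDr.
  by congr (_ - _); move: (dot v v) => D; clear; lra.
have p_cont : {within `[0, 1], continuous p}.
  by apply: derivable_within_continuous => s _; apply: ex_derive.
have [s + e] := MVT ltr01 (fun s _ => pd s) p_cont.
rewrite in_itv /= => /andP[s0 s1].
have qs : q s <= 0.
  have := @dot_le_of_enorm R d (gradient f (x + s *: v) - gradient f x) v (L * s).
  have -> : L * s * enorm v = L * enorm ((x + s *: v) - x).
    by rewrite addrAC subrr add0r enormZ ger0_norm ?ltW// mulrA.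
  move=> /(_ (mulr_gt0 L0 s0) (fL _ _)).
  rewrite dotDl dotNl => h.
  by rewrite /q subr_le0 cE.
move: e; rewrite /p /= !scale0r !scale1r addr0 (addrC x) subrK.
rewrite subr0 mulr1 expr0n expr1n !mulr0 mulr1 mul1r mul0r !subr0.
move: (f y) (f x) (q s) qs (L / 2 * dot v v) => a b u + w; lra.
Qed.

(** At every [z], the tangent of [f] at [y] lies below the quadratic upper bound at [x]. The claim
    is this comparison at the [z] minimizing the difference, [z = x - (gradient f x - gradient f y)
    / L]. *)
Lemma cocoercive (L : R) x y : 0 < L -> smooth L f -> convex_on_space f ->
  f y + dot (gradient f y) (x - y) +
    dot (gradient f x - gradient f y) (gradient f x - gradient f y) / (2 * L)
  <= f x.
Proof.
move=> L0 fL cf.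
have := fun z =>
  le_trans (convex_first_order y z cf) (smooth_upper_bound x z L0 fL).
move: (gradient f x) (gradient f y) => gx gy.
have [g ->] : exists g, gx = g + gy by exists (gx - gy); rewrite subrK.
move=> /(_ (x - L^-1 *: g)).
have -> : x - L^-1 *: g - x = - (L^-1 *: g) by rewrite addrC addKr.
have -> : x - L^-1 *: g - y = (x - y) - L^-1 *: g by rewrite addrAC.
rewrite addrK dotDr dotDl !(dotNr, dotNl, dotZr, dotZl) invfM.
have -> : L / 2 * - - (L^-1 * (L^-1 * dot g g)) = L^-1 * dot g g / 2.
  by move: (dot g g) => G; field; rewrite gt_eqF.
move: (dot g g) (dot gy g) (dot gy (x - y)) (f x) (f y) => a b c d1 d2.
lra.
Qed.
End SmoothConvex.

(** * Descent over one epoch *)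

Section Epoch.
Context (R : realType) (d n : nat) (f_ : 'I_n -> 'rV[R]_d -> R).
Hypothesis f_diff : forall i, differentiable_everywhere (f_ i).
Hypothesis f_convex : forall i, convex_on_space (f_ i).
Context (L : R).
Hypothesis L_gt0 : 0 < L.
Hypothesis f_smooth : forall i, smooth L (f_ i).

(** Exposes the inner iterates hidden in the fold: [y k] is the state after the first [k] steps. *)
Lemma epoch_states (gamma : R) (p : 'S_n) (x : 'rV[R]_d) :
  exists y : nat -> 'rV[R]_d, [/\ y 0 = x, y n = epoch f_ gamma p x &
    forall i : 'I_n, y i.+1 = y i - gamma *: gradient (f_ (p i)) (y i)].
Proof.
pose step y i := y - gamma *: gradient (f_ (p i)) y.
exists (fun k => foldl step x (take k (enum 'I_n))); split.
- by rewrite take0.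
- by rewrite -[X in take X _](size_enum_ord n) take_size.
- move=> i; rewrite (take_nth i) ?size_enum_ord//.
  by rewrite foldl_rcons nth_ord_enum.
Qed.

Lemma objective_sum (x : 'rV[R]_d) : n%:R * objective f_ x = \sum_i f_ i x.
Proof.
rewrite /objective; case: n f_ => [|m] g; first by rewrite big_ord0 mul0r.
by rewrite mulVKf// pnatr_eq0.
Qed.

(** Up to the factor [gamma ^+ 2], term [k] is the squared distance from inner iterate [k] to the
    end of the epoch if all gradients were taken at [xs]. *)
Definition tail_noise (xs : 'rV[R]_d) (p : 'S_n) : R :=
  \sum_(k < n) dot (\sum_(j < n | (k <= j)%N) gradient (f_ (p j)) xs)
                   (\sum_(j < n | (k <= j)%N) gradient (f_ (p j)) xs).

(** Co-coercivity bounds [f_ i x] from below around [y], smoothness bounds [f_ i z] from above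
    around [y]; subtracting eliminates [f_ i y]. *)
Lemma three_point i (x y z : 'rV[R]_d) :
  f_ i z - f_ i x
  + dot (gradient (f_ i) y - gradient (f_ i) x)
        (gradient (f_ i) y - gradient (f_ i) x) / (2 * L)
  - L / 2 * dot (z - y) (z - y) <= dot (gradient (f_ i) y) (z - x).
Proof.
have := cocoercive (f_diff i) x y L_gt0 (f_smooth i) (f_convex i).
have := smooth_upper_bound (f_diff i) y z L_gt0 (f_smooth i).
move: (gradient (f_ i) y) (gradient (f_ i) x) => a b.
rewrite -(opprB a b) dotNl dotNr opprK.
have -> : z - x = (z - y) - (x - y) by rewrite opprB addrA subrK.
move: (z - y) (x - y) (a - b) => u v w; rewrite dotDr dotNr.
move: (dot a u) (dot a v) (dot _ _ / (2 * L)) (L / 2 * _) (f_ i z) (f_ i y) (f_ i x).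
by move=> *; lra.
Qed.

Lemma tail_sub (gamma : R) (y : nat -> 'rV[R]_d) (a : 'I_n -> 'rV[R]_d) (k : nat) :
  (forall i : 'I_n, y i.+1 = y i - gamma *: a i) -> (k <= n)%N ->
  y n - y k = - (gamma *: \sum_(j < n | (k <= j)%N) a j).
Proof.
move=> ya kn; rewrite -telescope_sumr// big_geq_mkord scaler_sumr -sumrN.
by apply: eq_bigr => i _; rewrite ya addrC addKr.
Qed.

(** The epoch bound in abstract form: [h i] is the function visited at inner step [i], [a i] the
    gradient used there, [b i] its gradient at [xs]. *)
Lemma descent_of_three_point (gamma : R) (h : 'I_n -> 'rV[R]_d -> R)
    (y : nat -> 'rV[R]_d) (a b : 'I_n -> 'rV[R]_d) (xs : 'rV[R]_d) :
  0 <= gamma -> 2 * (gamma * L * n%:R) ^+ 2 <= 1 ->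
  (forall i : 'I_n, y i.+1 = y i - gamma *: a i) ->
  (forall i : 'I_n, h i (y n) - h i xs
    + dot (a i - b i) (a i - b i) / (2 * L) - L / 2 * dot (y n - y i) (y n - y i)
    <= dot (a i) (y n - xs)) ->
  2 * gamma * (\sum_i h i (y n) - \sum_i h i xs) <=
  dot (y 0 - xs) (y 0 - xs) - dot (y n - xs) (y n - xs)
  + 2 * gamma ^+ 3 * L *
    \sum_(k < n) dot (\sum_(j < n | (k <= j)%N) b j)
                     (\sum_(j < n | (k <= j)%N) b j).
Proof.
move=> g0 gL ya tp.
pose S := \sum_k dot (a k - b k) (a k - b k).
have tl k : (k <= n)%N ->
    y n - y k = - (gamma *: \sum_(j < n | (k <= j)%N) a j).
  exact: tail_sub.
(* Expand the square around the end point [y n]; the term [gamma^2 |sum a|^2] is dropped. *)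
have lin : dot (y n - xs) (y n - xs)
    + 2 * gamma * \sum_k dot (a k) (y n - xs) <= dot (y 0 - xs) (y 0 - xs).
  have -> : y 0 - xs = (y n - xs) + gamma *: \sum_k a k.
    by rewrite -[gamma *: _]opprK -(tl 0%N)// opprB [RHS]addrC addrA subrK.
  rewrite (dot_add_sqr (y n - xs)) dotZr (dotC _ (\sum_k a k)) dot_suml mulrA.
  by rewrite lerDl dot_ge0.
(* Split [a = (a - b) + b] in the tail sum. The [a - b] part has at most [n] terms, so its square is
   at most [n S]. *)
have step (k : 'I_n) : dot (y n - y k) (y n - y k) <=
    2 * gamma ^+ 2 * (n%:R * S)
    + 2 * gamma ^+ 2 * dot (\sum_(j < n | (k <= j)%N) b j)
                           (\sum_(j < n | (k <= j)%N) b j).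
  rewrite tl ?(ltnW (ltn_ord k))// dotNl dotNr opprK dotZl dotZr mulrA -expr2.
  set B := (X in _ <= _ + _ * X).
  rewrite (_ : _ + _ = gamma ^+ 2 * (2 * (n%:R * S) + 2 * B)); last by ring.
  apply: ler_wpM2l; first exact: sqr_ge0.
  under eq_bigr => j _ do rewrite -[a j](subrK (b j)).
  rewrite big_split /=; apply: le_trans (dot_add_sqr_le _ _) _.
  rewrite lerD2r ler_pM2l//.
  apply: le_trans (dot_sum_sqr_le [pred j : 'I_n | (k <= j)%N] _) _.
  apply: ler_pM.
  - exact: ler0n.
  - by apply: sumr_ge0 => j _; exact: dot_ge0.
  - by rewrite ler_nat -[X in (_ <= X)%N]card_ord max_card.
  - rewrite /S [leRHS](bigID [pred j : 'I_n | (k <= j)%N]) /= lerDl.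
    by apply: sumr_ge0 => j _; exact: dot_ge0.
set W := \sum_(k < n) dot _ _.
have tot : \sum_i h i (y n) - \sum_i h i xs + S / (2 * L)
    - L / 2 * (2 * gamma ^+ 2 * (n%:R ^+ 2 * S) + 2 * gamma ^+ 2 * W)
    <= \sum_k dot (a k) (y n - xs).
  apply: le_trans; last by apply: ler_sum => k _; exact: tp.
  rewrite sumrB big_split /= sumrB -mulr_suml -mulr_sumr.
  rewrite lerD2l lerN2 ler_pM2l ?divr_gt0//.
  apply: le_trans; first by apply: ler_sum => k _; exact: step.
  rewrite big_split /= sumr_const card_ord -mulr_sumr lerD2r.
  rewrite -[leLHS]mulr_natl [leLHS](_ : _ = 2 * gamma ^+ 2 * (n%:R ^+ 2 * S))//.
  by ring.
have S0 : 0 <= S by apply: sumr_ge0 => k _; exact: dot_ge0.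
(* The stepsize condition enters here: the [S] part of the errors is absorbed by the co-coercivity
   gain. *)
have SL : L / 2 * (2 * gamma ^+ 2 * (n%:R ^+ 2 * S)) <= S / (2 * L).
  rewrite ler_pdivlMr ?mulr_gt0//.
  have -> : L / 2 * (2 * gamma ^+ 2 * (n%:R ^+ 2 * S)) * (2 * L)
    = 2 * (gamma * L * n%:R) ^+ 2 * S by field.
  by rewrite ler_piMl.
move: tot SL lin.
clear step S0 tl; move: S W (\sum_k dot _ _) (dot _ _) (dot _ _) (\sum_i _ - _).
move=> S W s u v o tot SL lin.
have : 2 * gamma * (o - L * gamma ^+ 2 * W) <= 2 * gamma * s.
  apply: ler_wpM2l; first by rewrite mulr_ge0.
  by apply: le_trans tot; move: SL; lra.
by move: lin; lra.
Qed.

Lemma epoch_descent (gamma : R) (p : 'S_n) (x xs : 'rV[R]_d) :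
  0 <= gamma -> 2 * (gamma * L * n%:R) ^+ 2 <= 1 ->
  2 * gamma * n%:R * (objective f_ (epoch f_ gamma p x) - objective f_ xs) <=
  dot (x - xs) (x - xs)
  - dot (epoch f_ gamma p x - xs) (epoch f_ gamma p x - xs)
  + 2 * gamma ^+ 3 * L * tail_noise xs p.
Proof.
move=> g0 gL; have [y [<- <- ya]] := epoch_states gamma p x.
have sumE z : \sum_i f_ (p i) z = n%:R * objective f_ z.
  by rewrite objective_sum [RHS](reindex_inj (@perm_inj _ p)).
have := descent_of_three_point (h := fun k => f_ (p k)) g0 gL
  (a := fun k => gradient (f_ (p k)) (y k)) ya
  (fun k => three_point (p k) xs (y k) (y n)).
by rewrite !sumE -mulrBr mulrA.
Qed.
End Epoch.

(** * Partial sums under a random permutation *)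

Section PermutationMoments.
Context (R : realType) (d n : nat) (g : 'I_n -> 'rV[R]_d).

(** This is [n!] times the expected inner product of the vectors at positions [j] and [k] of a
    uniform permutation. *)
Let corr (j k : 'I_n) : R := \sum_(s : 'S_n) dot (g (s j)) (g (s k)).

(** Multiplication by [t] is a bijection of the symmetric group. *)
Lemma corr_perm (t : 'S_n) j k : corr (t j) (t k) = corr j k.
Proof.
rewrite /corr [RHS](reindex_inj (mulgI t)) /=.
by apply: eq_bigr => s _; rewrite !permM.
Qed.

Lemma corr_diag j k : corr j j = corr k k.
Proof. by rewrite -(corr_perm (tperm j k)) tpermL. Qed.

(* The symmetric group is 2-transitive. *)
Lemma corr_offdiag j k j' k' : j != k -> j' != k' -> corr j k = corr j' k'.
Proof.
(* First send [j] to [j'], then the image of [k] to [k']; the second transposition fixes [j']. *)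
move=> jk jk'; pose u := tperm j j'; pose t := (u * tperm (u k) k')%g.
have tj : t j = j'.
  rewrite permM tpermL tpermD//; last by rewrite eq_sym.
  by rewrite -(tpermL j j') (inj_eq perm_inj) eq_sym.
have tk : t k = k' by rewrite permM tpermL.
by rewrite -(corr_perm t) tj tk.
Qed.

Lemma card_tail (k : nat) : #|[pred j : 'I_n | (k <= j)%N]| = (n - k)%N.
Proof.
rewrite -sum1_card -(big_geq_mkord k n xpredT (fun=> 1%N)).
by rewrite sum_nat_const_nat muln1.
Qed.

(** By symmetry [corr] takes one value [a] on the diagonal and one value [c] off it, and
    [(n - 1) c = - a]. Summing [m (a + (m - 1) c)] over the tail lengths [m = 1, ..., n] gives
    [n (n + 1) a / 6], which is at most [n^2 a / 4] once [n >= 2]. *)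
Lemma sum_perm_sqr_tails :
  \sum_i g i = 0 ->
  \sum_(s : 'S_n) \sum_(k < n) dot (\sum_(j < n | (k <= j)%N) g (s j))
                                   (\sum_(j < n | (k <= j)%N) g (s j))
  <= n`!%:R * (n%:R / 4 * \sum_i dot (g i) (g i)).
Proof.
move=> g0.
(* With at most one vector, the zero sum makes every vector vanish; otherwise two distinct positions
   exist. *)
have [n1|n2] := leqP n 1.
  have gi i : g i = 0.
    rewrite -g0 (bigD1 i)//= big1 ?addr0// => j; rewrite -val_eqE /=.
    by have := ltn_ord i; have := ltn_ord j; lia.
  rewrite big1 ?mulr_ge0 ?divr_ge0 ?ler0n//.
    by apply: sumr_ge0 => i _; exact: dot_ge0.
  by move=> s _; rewrite big1// => k _; rewrite big1 ?dot0l// => j _.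
pose j0 := Ordinal (ltnW n2); pose j1 := Ordinal n2.
have n0 : (n%:R : R) != 0 by rewrite pnatr_eq0 -lt0n ltnW.
have corrE i j : corr i j = if i == j then corr j0 j0 else corr j0 j1.
  by case: eqVneq => [->|ij]; [exact: corr_diag|exact: corr_offdiag].
move: corrE; move: (corr j0 j0) (corr j0 j1) => a c corrE.
have row (Q : pred 'I_n) i : Q i ->
    \sum_(j | Q j) corr i j = a + (#|Q|%:R - 1) * c.
  move=> Qi; rewrite (bigD1 i)//= corrE eqxx; congr (_ + _).
  rewrite (eq_bigr (fun=> c)); last first.
    by move=> j /andP[_ ji]; rewrite corrE eq_sym (negPf ji).
  rewrite sumr_const -[LHS]mulr_natl; congr (_ * _).
  rewrite (cardD1 i Q) [i \in Q]Qi add1n -natr1 addrK; congr (_%:R).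
  by apply: eq_card => j; rewrite !inE andbC.
(* The vectors sum to zero, hence so does each row of correlations. *)
have ac : a + (n%:R - 1) * c = 0.
  rewrite -[n in n%:R]card_ord -(row xpredT j0)// /corr exchange_big /= big1// => s _.
  rewrite -dot_sumr; have -> : \sum_i g (s i) = \sum_i g i.
    by rewrite [RHS](reindex_inj (@perm_inj _ s)).
  by rewrite g0 dotC dot0l.
have na : n%:R * a = n`!%:R * \sum_i dot (g i) (g i).
  transitivity (\sum_(j < n) corr j j).
    by under eq_bigr do rewrite corrE eqxx; rewrite sumr_const card_ord mulr_natl.
  rewrite exchange_big /= (eq_bigr (fun=> \sum_i dot (g i) (g i))) => [|s _].
    by rewrite sumr_const -[n`!](card_Sn n) mulr_natl.
  by rewrite [RHS](reindex_inj (@perm_inj _ s)).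
have sq k : \sum_(s : 'S_n) dot (\sum_(j < n | (k <= j)%N) g (s j))
                                (\sum_(j < n | (k <= j)%N) g (s j))
    = (n - k)%:R * (a + ((n - k)%:R - 1) * c).
  under eq_bigr => s _.
    rewrite dot_suml; under eq_bigr do rewrite dot_sumr; over.
  rewrite exchange_big /=; under eq_bigr do rewrite exchange_big /=.
  under eq_bigr => i ki do rewrite (row [pred j : 'I_n | (k <= j)%N] i ki).
  by rewrite sumr_const card_tail mulr_natl.
rewrite exchange_big /=; under eq_bigr do rewrite sq.
(* The closed form keeps [(m - 1) c] as a factor, to be replaced by [- a] at [m = n]. *)
have aux m : \sum_(i < m) i.+1%:R * (a + (i.+1%:R - 1) * c) =
    m%:R * (m%:R + 1) / 2 * a + (m%:R - 1) * c * (m%:R * (m%:R + 1) / 3).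
  elim: m => [|m IH]; first by rewrite big_ord0; ring.
  by rewrite big_ord_recr /= IH -natr1; field.
(* Reversing the index turns the tail length [n - k] into [i + 1]. *)
rewrite (reindex_inj rev_ord_inj) /=.
under eq_bigr => i _ do rewrite subKn ?ltn_ord//.
rewrite aux (_ : (n%:R - 1) * c = - a); last first.
  by apply/eqP; rewrite -addr_eq0 addrC ac.
rewrite [leRHS]mulrCA -na.
have a0 : 0 <= n%:R * a.
  by rewrite na mulr_ge0// sumr_ge0// => i _; exact: dot_ge0.
have N2 : 2 <= n%:R :> R by rewrite ler_nat.
rewrite -subr_ge0.
rewrite (_ : _ - _ = n%:R * a * (n%:R - 2) / 12); last by field.
by apply: divr_ge0 => //; apply: mulr_ge0; rewrite ?subr_ge0.
Qed.
End PermutationMoments.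

(** * Trajectories and rates *)

(** Sum the tangent inequalities at the average [z]; the linear terms cancel. *)
Lemma jensen_average (R : realType) (d : nat) (f : 'rV[R]_d -> R) (T : nat)
    (x : nat -> 'rV[R]_d) :
  differentiable_everywhere f -> convex_on_space f -> (0 < T)%N ->
  T%:R * f (T%:R^-1 *: \sum_(1 <= j < T.+1) x j) <= \sum_(1 <= j < T.+1) f (x j).
Proof.
move=> df cf T0; set z := _ *: _.
have := ler_sum (index_iota 1 T.+1) (P := xpredT)
  (fun j _ => convex_first_order df z (x j) cf).
rewrite big_split /= -dot_sumr sumrB !big_const_nat !iter_addr_0 subSS subn0.
rewrite -[z *+ T]scaler_nat /z scalerA divff ?pnatr_eq0 -?lt0n// scale1r subrr.
by rewrite dotC dot0l addr0 mulr_natl.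
Qed.

Section Trajectory.
Context (R : realType) (d n : nat) (f_ : 'I_n -> 'rV[R]_d -> R).
Hypothesis n_gt0 : (0 < n)%N.
Hypothesis f_diff : forall i, differentiable_everywhere (f_ i).
Hypothesis f_convex : forall i, convex_on_space (f_ i).
Context (L : R).
Hypothesis L_gt0 : 0 < L.
Hypothesis f_smooth : forall i, smooth L (f_ i).
Context (xs : 'rV[R]_d).
Hypothesis xs_min : minimizer (objective f_) xs.

Let nR_gt0 : 0 < n%:R :> R. Proof. by rewrite ltr0n. Qed.

(** A step of length [c = 1 / (n L)] from [xs] along [- G] lowers the sum of the components by at
    least [c |G|^2 / 2], so minimality forces [G = 0]. *)
Lemma sum_gradient_minimizer : \sum_i gradient (f_ i) xs = 0.
Proof.
set G := \sum_i _; apply: dot_eq0; apply/eqP; rewrite eq_le dot_ge0 andbT.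
set c := (n%:R * L)^-1; set y := xs - c *: G.
have c0 : 0 < c by rewrite invr_gt0 mulr_gt0.
have := ler_sum (index_enum 'I_n) (P := xpredT)
  (fun i _ => smooth_upper_bound (f_diff i) xs y L_gt0 (f_smooth i)).
rewrite !big_split /= -dot_suml -/G -!objective_sum sumr_const card_ord.
have -> : y - xs = - (c *: G) by rewrite /y addrC addKr.
rewrite !(dotNr, dotNl) opprK !(dotZl, dotZr).
have := xs_min y; rewrite -(ler_pM2l nR_gt0).
move: (n%:R * _) (n%:R * _) (dot G G) => u v w uv.
have -> : (L / 2 * (c * (c * w))) *+ n = c * w / 2.
  rewrite -mulr_natl /c; field; apply/andP.
  by rewrite !gt_eqF.
by move=> h; rewrite -(ler_pM2l c0) mulr0; lra.
Qed.

(** The epoch bounds telescope; the last squared distance stays on the left to carry the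
    induction. *)
Lemma iterate_distance (gamma : R) (perms : nat -> 'S_n) (x0 : 'rV[R]_d) T :
  0 <= gamma -> 2 * (gamma * L * n%:R) ^+ 2 <= 1 ->
  2 * gamma * n%:R * \sum_(1 <= j < T.+1)
    (objective f_ (iterate f_ gamma perms x0 j) - objective f_ xs)
  + dot (iterate f_ gamma perms x0 T - xs) (iterate f_ gamma perms x0 T - xs) <=
  dot (x0 - xs) (x0 - xs)
  + 2 * gamma ^+ 3 * L * \sum_(t < T) tail_noise f_ xs (perms t).
Proof.
move=> g0 gL; elim: T => [|T IH].
  by rewrite big_geq// big_ord0 !mulr0 add0r addr0.
rewrite big_nat_recr//= big_ord_recr /=.
have := epoch_descent f_diff f_convex L_gt0 f_smooth (perms T)
  (iterate f_ gamma perms x0 T) xs g0 gL.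
move: (dot _ _) (dot _ _) (dot _ _) IH => u v w.
move: (tail_noise _ _ _) (\sum_(t < T) _) (\sum_(1 <= j < T.+1) _) => a b c.
move: (objective _ _) (objective _ _) => o p IH.
lra.
Qed.

Lemma objective_average (gamma : R) (perms : nat -> 'S_n) (x0 : 'rV[R]_d) T :
  (0 < T)%N ->
  T%:R * (objective f_ (average_iterate f_ gamma perms x0 T) - objective f_ xs)
  <= \sum_(1 <= j < T.+1)
       (objective f_ (iterate f_ gamma perms x0 j) - objective f_ xs).
Proof.
move=> T0; rewrite sumrB sumr_const_nat subSS subn0 mulrBr.
rewrite [T%:R * objective f_ xs]mulr_natl.
rewrite lerD2r -(ler_pM2l nR_gt0) mulrCA objective_sum mulr_sumr mulr_sumr.
under [leRHS]eq_bigr do rewrite objective_sum.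
rewrite exchange_big /=; apply: ler_sum => i _.
exact: jensen_average.
Qed.

Lemma average_gap_le (gamma : R) (perms : nat -> 'S_n) (x0 : 'rV[R]_d) T :
  (0 < T)%N -> 0 < gamma -> 2 * (gamma * L * n%:R) ^+ 2 <= 1 ->
  objective f_ (average_iterate f_ gamma perms x0 T) - objective f_ xs <=
  enorm (x0 - xs) ^+ 2 / (2 * gamma * n%:R * T%:R)
  + gamma ^+ 2 * L / (n%:R * T%:R) * \sum_(t < T) tail_noise f_ xs (perms t).
Proof.
move=> T0 g0 gL.
have TR : 0 < T%:R :> R by rewrite ltr0n.
have c0 : 0 < 2 * gamma * n%:R by rewrite !mulr_gt0.
have := iterate_distance perms x0 T (ltW g0) gL.
have := objective_average gamma perms x0 T0.
rewrite enorm_sqr -(ler_pM2l c0).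
have := dot_ge0 (iterate f_ gamma perms x0 T - xs).
move: (dot _ _) (dot _ _) (\sum_(t < T) _) (2 * gamma * n%:R * \sum_(1 <= j < T.+1) _).
move: (_ - objective _ _) => o v u w s u0 h1 h2.
have h : 2 * gamma * n%:R * (T%:R * o) <= v + 2 * gamma ^+ 3 * L * w by lra.
rewrite -(ler_pM2l (mulr_gt0 c0 TR)) -[leLHS]mulrA; apply: le_trans h _.
rewrite le_eqVlt; apply/orP; left; apply/eqP; field.
by rewrite !gt_eqF.
Qed.

End Trajectory.

(** * From the stepsize to the rate and the iteration count *)

Section Rates.
Context (R : realType).
Implicit Types x y : R.

Lemma powR13_cube x : 0 <= x -> (x `^ (1 / 3)) ^+ 3 = x.
Proof.
move=> x0; rewrite -powR_mulrn ?powR_ge0// -powRrM.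
by rewrite (_ : 1 / 3 * 3%:R = 1) ?powRr1//; field.
Qed.

Lemma cube_powR13 x : 0 <= x -> (x ^+ 3) `^ (1 / 3) = x.
Proof.
move=> x0; rewrite -powR_mulrn// -powRrM.
by rewrite (_ : 3%:R * (1 / 3) = 1) ?powRr1//; field.
Qed.

Lemma powR23 x : x `^ (2 / 3) = (x `^ (1 / 3)) ^+ 2.
Proof.
rewrite -powR_mulrn ?powR_ge0// -powRrM; congr (_ `^ _); lra.
Qed.

Lemma powR43 x : x `^ (4 / 3) = (x `^ (1 / 3)) ^+ 4.
Proof.
rewrite -powR_mulrn ?powR_ge0// -powRrM; congr (_ `^ _); lra.
Qed.

Definition rate (L D s n T : R) : R :=
  L * D ^+ 2 / (Num.sqrt 2 * T)
  + 3 * L `^ (1 / 3) * D `^ (4 / 3) * s `^ (2 / 3)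
    / (4 * n `^ (1 / 3) * T `^ (2 / 3)).

(** At zero noise only the first term of [rate] survives, since [0] to the power [2 / 3] is [0]. The
    equality also identifies that term in [rate_step]. *)
Lemma rate_large_step (L D n T : R) : 0 < L -> 0 < n -> 0 < T ->
  D ^+ 2 / (2 * (1 / (Num.sqrt 2 * L * n)) * n * T) = rate L D 0 n T.
Proof.
move=> L0 n0 T0; rewrite /rate (powR0 (x := 2 / 3)) ?gt_eqF// mulr0 mul0r addr0.
have r0 : 0 < Num.sqrt 2 :> R by rewrite sqrtr_gt0.
have r2 : Num.sqrt 2 ^+ 2 = 2 :> R by rewrite sqr_sqrtr.
move: (Num.sqrt 2) r0 r2 => r r0 r2; rewrite -r2; field.
by rewrite !gt_eqF.
Qed.

(** For the minimum [gamma] of [a] and [q], [1 / gamma <= 1 / a + 1 / q] and [gamma^2 <= q^2]. The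
    [1 / a] part is the first term of [rate]. The [1 / q] and [q^2] parts are one half and one
    quarter of the same quantity, whence the constant [3 / 4]. *)
Lemma rate_step (L D s n T gamma : R) :
  0 < L -> 0 < D -> 0 < s -> 0 < n -> 0 < T ->
  gamma = Num.min (1 / (Num.sqrt 2 * L * n))
            ((D ^+ 2 / (L * n ^+ 2 * T * s ^+ 2)) `^ (1 / 3)) ->
  D ^+ 2 / (2 * gamma * n * T) + gamma ^+ 2 * L * n * s ^+ 2 / 4
  <= rate L D s n T.
Proof.
move=> L0 D0 s0 n0 T0; rewrite /rate.
have := rate_large_step D L0 n0 T0.
rewrite /rate (powR0 (x := 2 / 3)) ?gt_eqF// mulr0 mul0r addr0 => <-.
rewrite powR43 !powR23.
set a := 1 / _; set q := (X in Num.min a X) => gE.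
have a0 : 0 < a by rewrite divr_gt0 ?mulr_gt0// sqrtr_gt0.
have q0 : 0 < q by rewrite powR_gt0// divr_gt0 ?mulr_gt0 ?exprn_gt0.
have g0 : 0 < gamma by rewrite gE lt_min a0.
have gq : gamma ^+ 2 <= q ^+ 2.
  by rewrite ler_sqr ?nnegrE ?(ltW g0) ?(ltW q0)// gE ge_min lexx orbT.
have gi : gamma^-1 <= a^-1 + q^-1.
  by rewrite gE minElt; case: ifP => _; rewrite ?lerDl ?lerDr invr_ge0 ltW.
have -> : D ^+ 2 / (2 * gamma * n * T) = D ^+ 2 / (2 * n * T) * gamma^-1.
  by field; rewrite !gt_eqF.
have -> : D ^+ 2 / (2 * a * n * T) = D ^+ 2 / (2 * n * T) * a^-1.
  by field; rewrite !gt_eqF.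
have c0 : 0 <= D ^+ 2 / (2 * n * T) by rewrite divr_ge0 ?mulr_ge0 ?sqr_ge0 ?ltW.
have e0 : 0 <= L * n * s ^+ 2 / 4 by rewrite divr_ge0 ?mulr_ge0 ?sqr_ge0 ?ltW.
have := ler_wpM2l c0 gi; have := ler_wpM2l e0 gq; rewrite mulrDr.
suff -> : 3 * L `^ (1 / 3) * (D `^ (1 / 3)) ^+ 4 * (s `^ (1 / 3)) ^+ 2
    / (4 * n `^ (1 / 3) * (T `^ (1 / 3)) ^+ 2)
    = L * n * s ^+ 2 / 4 * q ^+ 2 + D ^+ 2 / (2 * n * T) * q^-1.
  move: (D ^+ 2 / (2 * n * T)) c0 => w w0.
  rewrite -!(mulrA L) -[_ * L * _ * _]mulrA; lra.
have cube x : 0 < x -> exists2 y, 0 < y & x `^ (1 / 3) = y /\ x = y ^+ 3.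
  by move=> x0; exists (x `^ (1 / 3)); [exact: powR_gt0|rewrite powR13_cube ?ltW].
(* In terms of the five cube roots both sides are rational functions. *)
rewrite /q.
have [l l0 [-> ->]] := cube _ L0; have [e e1 [-> ->]] := cube _ D0.
have [u u0 [-> ->]] := cube _ s0; have [v v0 [-> ->]] := cube _ n0.
have [t t0 [-> ->]] := cube _ T0.
rewrite [X in X `^ _](_ : _ = (e ^+ 2 / (l * v ^+ 2 * t * u ^+ 2)) ^+ 3); last first.
  by field; rewrite !gt_eqF.
rewrite cube_powR13; last by rewrite divr_ge0 ?mulr_ge0 ?sqr_ge0 ?ltW.
by field; rewrite !gt_eqF.
Qed.

(** The first entry of the maximum bounds the first term of [rate] by [eps^2 / 4]; the second entry
    bounds the other term by [3 eps^2 / 4]. *)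
Lemma rate_le_sqr (L D s n T eps : R) :
  0 < L -> 0 <= D -> 0 <= s -> 0 < n -> 0 < T -> 0 < eps ->
  2 * D ^+ 2 * Num.sqrt (L * n) / eps ^+ 2
      * Num.max (Num.sqrt (2 * L * n)) (s / eps) <= T * n ->
  rate L D s n T <= eps ^+ 2.
Proof.
move=> L0 D0 s0 n0 T0 e0 H.
have Ln0 : 0 < L * n by rewrite mulr_gt0.
have c0 : 0 <= 2 * D ^+ 2 * Num.sqrt (L * n) / eps ^+ 2.
  by rewrite !(sqr_ge0, sqrtr_ge0, divr_ge0, mulr_ge0).
have r0 : 0 < Num.sqrt 2 :> R by rewrite sqrtr_gt0.
have r2 : Num.sqrt 2 ^+ 2 = 2 :> R by rewrite sqr_sqrtr.
have q2 : Num.sqrt (L * n) ^+ 2 = L * n by rewrite sqr_sqrtr ?ltW.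
have H1 : 2 * D ^+ 2 * Num.sqrt (L * n) / eps ^+ 2 * Num.sqrt (2 * L * n) <= T * n.
  by apply: le_trans H; rewrite ler_wpM2l// le_max lexx.
have H2 : 2 * D ^+ 2 * Num.sqrt (L * n) / eps ^+ 2 * (s / eps) <= T * n.
  by apply: le_trans H; rewrite ler_wpM2l// le_max lexx orbT.
move: H1 H2; rewrite -(mulrA 2 L n) (@sqrtrM _ 2 (L * n))//.
move: (Num.sqrt (L * n)) q2 (sqrtr_ge0 (L * n)) => q q2 q0 H1 H2.
have t1 : L * D ^+ 2 / (Num.sqrt 2 * T) <= eps ^+ 2 / 4.
  have {}H1 : 2 * D ^+ 2 * Num.sqrt 2 * (L * n) / eps ^+ 2 <= T * n.
    by apply: le_trans H1; rewrite -q2 le_eqVlt; apply/orP; left; apply/eqP; ring.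
  have {}H1 : 2 * Num.sqrt 2 * (L * D ^+ 2) <= T * eps ^+ 2.
    rewrite -(ler_pM2r n0); move: H1; rewrite ler_pdivrMr ?exprn_gt0// => H1.
    by apply: le_trans (le_trans H1 _); rewrite le_eqVlt; apply/orP; left; apply/eqP; ring.
  rewrite ler_pdivrMr ?mulr_gt0//.
  rewrite -(ler_pM2l (mulr_gt0 (ltr0Sn _ 1) r0)); apply: le_trans H1 _.
  rewrite le_eqVlt; apply/orP; left; apply/eqP.
  transitivity (Num.sqrt 2 ^+ 2 / 2 * (T * eps ^+ 2)); last by field.
  by rewrite r2; field.
have t2 : L `^ (1 / 3) * D `^ (4 / 3) * s `^ (2 / 3)
    / (n `^ (1 / 3) * T `^ (2 / 3)) <= eps ^+ 2.
  rewrite powR43 !powR23.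
  set K := (X in X <= _).
  have K0 : 0 <= K by rewrite divr_ge0 ?mulr_ge0 ?exprn_ge0 ?powR_ge0.
  (* Cubing removes the fractional powers; the claim then follows from the square of [H2], with a
     factor 4 to spare. *)
  rewrite -(@ler_pXn2r _ 3) ?nnegrE ?sqr_ge0//.
  have -> : K ^+ 3 = L * D ^+ 4 * s ^+ 2 / (n * T ^+ 2).
    rewrite -[in RHS](powR13_cube (ltW L0)) -[in RHS](powR13_cube D0).
    rewrite -[in RHS](powR13_cube s0) -[in RHS](powR13_cube (ltW n0)).
    rewrite -[in RHS](powR13_cube (ltW T0)) /K; field.
    by rewrite !gt_eqF ?powR_gt0.
  rewrite ler_pdivrMr ?mulr_gt0 ?exprn_gt0//.
  have {}H2 : 2 * D ^+ 2 * q * s <= T * n * eps ^+ 3.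
    rewrite -ler_pdivrMr ?exprn_gt0//; apply: le_trans H2.
    by rewrite le_eqVlt; apply/orP; left; apply/eqP; field; rewrite gt_eqF.
  have := H2; rewrite -ler_sqr ?nnegrE; first last.
  - by rewrite !mulr_ge0 ?exprn_ge0 ?ltW.
  - by rewrite !mulr_ge0 ?sqrtr_ge0 ?exprn_ge0.
  rewrite !exprMn q2 -(ler_pM2r n0) => {}H2.
  have B0 : 0 <= n ^+ 2 * (eps ^+ 3 * eps ^+ 3 * (n * T ^+ 2)).
    by rewrite !(mulr_ge0, exprn_ge0) ?ltW.
  rewrite -(ler_pM2l (exprn_gt0 2 n0)); move: B0 H2; clear; lra.
rewrite /rate.
have -> : 3 * L `^ (1 / 3) * D `^ (4 / 3) * s `^ (2 / 3)
    / (4 * n `^ (1 / 3) * T `^ (2 / 3))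
    = 3 / 4 * (L `^ (1 / 3) * D `^ (4 / 3) * s `^ (2 / 3)
    / (n `^ (1 / 3) * T `^ (2 / 3))).
  by field; rewrite !gt_eqF ?powR_gt0.
lra.
Qed.
End Rates.

(** * Expectation *)

Section FiniteValued.
Context (R : realType) (disp : measure_display) (Omega : measurableType disp).
Context (P : probability Omega R).

(** The preimage of any set under [h \o q] is a finite union of fibres of [q]. *)
Lemma measurable_fun_finite (I : finType) (q : Omega -> I) (h : I -> R) :
  (forall i, measurable (q @^-1` [set i])) -> measurable_fun setT (h \o q).
Proof.
move=> mq _ Y _; rewrite setTI.
have -> : (h \o q) @^-1` Y = \bigcup_(i in [set i | Y (h i)]) (q @^-1` [set i]).
  apply/seteqP; split => [w Yw|w [i /= Yi qi]]; last by rewrite qi.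
  by exists (q w).
by apply: fin_bigcup_measurable => //; exact: finite_finset.
Qed.

Lemma expectation_uniform_perm (n : nat) (q : Omega -> 'S_n) (W : 'S_n -> R) :
  uniform_perm P q -> (forall s, 0 <= W s) ->
  'E_P[W \o q]%E = (n`!%:R^-1 * \sum_s W s)%:E.
Proof.
move=> uq W0; rewrite unlock.
(* Write [W \o q] as a finite combination of the indicators of the fibres; nonnegativity lets sum
   and integral be exchanged. *)
transitivity (\int[P]_w (\sum_s (W s)%:E * (\1_(q @^-1` [set s]) w)%:E)%E)%E.
  apply: eq_integral => w _ /=.
  rewrite (bigD1 (q w))//= big1 => [|s sq].
    by rewrite indicE mem_set// mule1 adde0.
  by rewrite indicE memNset ?mule0// => /= e; rewrite e eqxx in sq.
rewrite ge0_integral_sum//=; last 2 first.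
- move=> s; apply/measurable_EFinP; apply: measurable_funM => //.
  by apply: measurable_indic; case: (uq s).
- by move=> s w _; rewrite mule_ge0// lee_fin// indicE.
rewrite mulr_sumr -sumEFin; apply: eq_bigr => s _.
have [mq Pq] := uq s.
rewrite ge0_integralZl_EFin//.
- by rewrite integral_indic// setIT [X in (_ * X)%E]Pq -EFinM mulrC.
- by apply/measurable_EFinP; exact: measurable_indic.
Qed.
End FiniteValued.

Lemma iterate_ext (R : realType) (d n : nat) (f_ : 'I_n -> 'rV[R]_d -> R)
    (gamma : R) (p q : nat -> 'S_n) (x0 : 'rV[R]_d) (j T : nat) :
  (forall t, (t < T)%N -> p t = q t) -> (j <= T)%N ->
  iterate f_ gamma p x0 j = iterate f_ gamma q x0 j.
Proof.
by move=> pq; elim: j => [//|j IH] jT; rewrite /= (IH (ltnW jT)) (pq _ jT).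
Qed.

(** Serves the degenerate case where the stepsize formula returns 0. *)
Lemma iterate_step0 (R : realType) (d n : nat) (f_ : 'I_n -> 'rV[R]_d -> R)
    (p : nat -> 'S_n) (x0 : 'rV[R]_d) (j : nat) :
  iterate f_ 0 p x0 j = x0.
Proof.
have step0 (v : 'rV[R]_d) : x0 - 0 *: v = x0 by rewrite scale0r subr0.
elim: j => [//|j IH]; rewrite [LHS]/= IH /epoch.
by elim: (enum _) => [//|i s IHs]; rewrite [LHS]/= step0.
Qed.

(** * Expected gap of the average iterate for uniform permutations *)

Section ExpectedGap.
Context (R : realType) (d n : nat) (f_ : 'I_n -> 'rV[R]_d -> R).
Context (disp : measure_display) (Omega : measurableType disp).
Context (P : probability Omega R) (perms : nat -> Omega -> 'S_n) (T : nat).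
Hypothesis T_gt0 : (0 < T)%N.
Hypothesis perms_uniform : forall t, (t < T)%N -> uniform_perm P (perms t).

Lemma measurable_average (gamma : R) (x0 : 'rV[R]_d) (h : 'rV[R]_d -> R) :
  measurable_fun setT
    (fun w => h (average_iterate f_ gamma (fun t => perms t w) x0 T)).
Proof.
pose q w := [ffun t : 'I_T => perms t w].
(* The average factors through the finite tuple of the first [T] permutations; from epoch [T] on,
   [ext] takes the identity, which [iterate_ext] shows to be harmless. *)
pose ext (p : {ffun 'I_T -> 'S_n}) (t : nat) : 'S_n :=
  if insub t is Some i then p i else 1%g.
have -> : (fun w => h (average_iterate f_ gamma (fun t => perms t w) x0 T)) =
    (fun p => h (average_iterate f_ gamma (ext p) x0 T)) \o q.
  apply/funext => w /=; congr (h (_ *: _)); apply: eq_big_nat => j /andP[_ jT].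
  apply: (@iterate_ext _ _ _ _ _ _ _ _ _ T) jT => t tT.
  by rewrite /ext insubT ffunE.
apply: measurable_fun_finite => p.
have -> : q @^-1` [set p] =
    \bigcap_(t in [set: 'I_T]) (perms t @^-1` [set p t]).
  apply/seteqP; split => w /=; first by move=> <- t _ /=; rewrite ffunE.
  by move=> wp; apply/ffunP => t; rewrite ffunE; exact: wp.
apply: fin_bigcap_measurable => [|t _]; first exact: finite_finset.
by have [] := perms_uniform (ltn_ord t) (p t).
Qed.

Hypothesis n_gt0 : (0 < n)%N.
Hypothesis f_diff : forall i, differentiable_everywhere (f_ i).
Hypothesis f_convex : forall i, convex_on_space (f_ i).
Context (L : R).
Hypothesis L_gt0 : 0 < L.
Hypothesis f_smooth : forall i, smooth L (f_ i).
Context (xs : 'rV[R]_d).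
Hypothesis xs_min : minimizer (objective f_) xs.

Lemma tail_noise_ge0 p : 0 <= tail_noise f_ xs p.
Proof. by apply: sumr_ge0 => k _; exact: dot_ge0. Qed.

(** The squared gradient norms at [xs] sum to [n] times the squared [sigma_star], so the factor
    [n / 4] becomes [n^2 / 4]. *)
Lemma sum_tail_noise_le :
  n`!%:R^-1 * \sum_p tail_noise f_ xs p <= n%:R ^+ 2 / 4 * sigma_star f_ xs ^+ 2.
Proof.
have n0 : 0 < n%:R :> R by rewrite ltr0n.
have := sum_perm_sqr_tails
  (sum_gradient_minimizer n_gt0 f_diff L_gt0 f_smooth xs_min).
rewrite ler_pdivrMl ?ltr0n ?fact_gt0// => h; apply: le_trans h _.
rewrite ler_pM2l ?ltr0n ?fact_gt0//.
rewrite sqr_sqrtr; last first.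
  by rewrite mulr_ge0 ?invr_ge0 ?(ltW n0)// sumr_ge0// => i _; exact: sqr_ge0.
under [in leRHS]eq_bigr do rewrite enorm_sqr.
rewrite le_eqVlt; apply/orP; left; apply/eqP; field.
by rewrite gt_eqF.
Qed.

(** Take expectations in the pathwise bound [average_gap_le]; by linearity each of the [T] epochs
    contributes its mean [tail_noise]. *)
Lemma expected_gap_le (gamma : R) (x0 : 'rV[R]_d) :
  0 < gamma -> 2 * (gamma * L * n%:R) ^+ 2 <= 1 ->
  ('E_P[(fun w => objective f_ (average_iterate f_ gamma (fun t => perms t w) x0 T)
                 - objective f_ xs)%R] <=
   (enorm (x0 - xs) ^+ 2 / (2 * gamma * n%:R * T%:R)
    + gamma ^+ 2 * L * n%:R * sigma_star f_ xs ^+ 2 / 4)%:E)%E.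
Proof.
move=> g0 gL.
have nR : 0 < n%:R :> R by rewrite ltr0n.
have TR : 0 < T%:R :> R by rewrite ltr0n.
set A := enorm _ ^+ 2 / _.
have A0 : 0 <= A by rewrite divr_ge0 ?sqr_ge0// ltW// !mulr_gt0.
pose c := gamma ^+ 2 * L / (n%:R * T%:R).
have c0 : 0 <= c by rewrite divr_ge0 ?mulr_ge0 ?sqr_ge0 ?ltW.
pose W t w := c * tail_noise f_ xs (perms t w).
have W0 t w : 0 <= W t w by rewrite mulr_ge0// tail_noise_ge0.
have mW (t : 'I_T) : measurable_fun setT (W t).
  apply: (measurable_fun_finite (fun s => c * tail_noise f_ xs s)) => s.
  by have [] := perms_uniform (ltn_ord t) s.
have mS : measurable_fun setT (fun w => \sum_(t < T) W t w).
  exact: measurable_sum.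
apply: (@le_trans _ _ 'E_P[(fun w => A + \sum_(t < T) W t w)%R]%E).
  apply: expectation_le.
  - exact: (measurable_average gamma x0 (fun x => objective f_ x - objective f_ xs)).
  - exact: measurable_funD.
  (* The gap is nonnegative because [xs] is a minimizer. *)
  - by move=> w; rewrite subr_ge0.
  - by move=> w; rewrite addr_ge0// sumr_ge0.
  - apply: aeW => w; rewrite /W -mulr_sumr.
    exact: (average_gap_le n_gt0 f_diff f_convex L_gt0 f_smooth xs
      (fun t => perms t w) x0 T_gt0 g0 gL).
rewrite unlock.
under eq_integral => w _ do rewrite EFinD -sumEFin.
rewrite ge0_integralD//; last 2 first.
- by move=> w _; apply: sume_ge0 => t _; rewrite lee_fin.
- by apply: emeasurable_sum => t; apply/measurable_EFinP; exact: mW.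
rewrite ge0_integral_sum//; last 2 first.
- by move=> t; apply/measurable_EFinP; exact: mW.
- by move=> t w _; rewrite lee_fin.
rewrite integral_cst//= probability_setT mule1 EFinD leeD2l//.
apply: (@le_trans _ _ (\sum_(t < T) (c * (n%:R ^+ 2 / 4 * sigma_star f_ xs ^+ 2))%:E)%E).
  apply: lee_sum => t _.
  have := expectation_uniform_perm (perms_uniform (ltn_ord t))
    (fun s => mulr_ge0 c0 (tail_noise_ge0 s)).
  rewrite unlock => ->; rewrite lee_fin -mulr_sumr mulrCA.
  by rewrite ler_wpM2l// sum_tail_noise_le.
rewrite sumEFin lee_fin sumr_const card_ord /c.
rewrite le_eqVlt; apply/orP; left; apply/eqP; rewrite -mulr_natl; field.
by rewrite !gt_eqF.
Qed.
End ExpectedGap.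

Unset Implicit Arguments.
Set Strict Implicit.

Theorem corollary2
    (R : realType) (d n : nat) (n_gt0 : (0 < n)%N)
    (f_ : 'I_n -> 'rV[R]_d -> R)
    (f_diff : forall i, differentiable_everywhere (f_ i))
    (f_convex : forall i, convex_on_space (f_ i))
    (L : R) (L_gt0 : 0 < L)
    (f_smooth : forall i, smooth L (f_ i))
    (F_smooth : smooth L (objective f_))
    (xs : 'rV[R]_d) (xs_min : minimizer (objective f_) xs)
    (T : nat) (T_gt0 : (0 < T)%N) (x0 : 'rV[R]_d)
    (disp : measure_display) (Omega : measurableType disp)
    (P : probability Omega R) (perms : nat -> Omega -> 'S_n)
    (perms_law : random_reshuffling P T perms \/ shuffle_once P T perms) :
  let gamma := stepsize f_ L T x0 xs in
  let sigma := sigma_star f_ xs in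
  let D := enorm (x0 - xs) in
  let gap := fun w : Omega =>
    objective f_ (average_iterate f_ gamma (fun t => perms t w) x0 T)
    - objective f_ xs in
  ('E_P[gap] <=
    (L * D ^+ 2 / (Num.sqrt 2 * T%:R)
     + 3 * L `^ (1 / 3) * D `^ (4 / 3) * sigma `^ (2 / 3)
       / (4 * n%:R `^ (1 / 3) * T%:R `^ (2 / 3)))%:E)%E
  /\
  (forall eps : R, 0 < eps ->
    2 * D ^+ 2 * Num.sqrt (L * n%:R) / eps ^+ 2
      * Num.max (Num.sqrt (2 * L * n%:R)) (sigma / eps)
      <= T%:R * n%:R ->
    ('E_P[gap] <= (eps ^+ 2)%:E)%E).
Proof.
(* The two sampling schemes merge here. *)
have perms_uniform t : (t < T)%N -> uniform_perm P (perms t).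
  case: perms_law => [[up _]|[p [up pE]] tT]; first exact: up.
  by rewrite (_ : perms t = p)//; apply/funext => w; exact: pE.
have nR : 0 < n%:R :> R by rewrite ltr0n.
have TR : 0 < T%:R :> R by rewrite ltr0n.
have r0 : 0 < Num.sqrt 2 :> R by rewrite sqrtr_gt0.
have r2 : Num.sqrt 2 ^+ 2 = 2 :> R by rewrite sqr_sqrtr.
move=> gamma sigma D gap.
have s0 : 0 <= sigma by exact: sqrtr_ge0.
have main : ('E_P[gap] <= (rate L D sigma n%:R T%:R)%:E)%E.
  set a := 1 / (Num.sqrt 2 * L * n%:R).
  have a0 : 0 < a by rewrite divr_gt0 ?mulr_gt0.
  (* So [2 (a L n)^2 = 1]: [a] is the largest step that the epoch bound allows. *)
  have aL : a * L * n%:R = (Num.sqrt 2)^-1 by rewrite /a; field; rewrite !gt_eqF.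
  have small g : 0 < g -> g <= a -> 2 * (g * L * n%:R) ^+ 2 <= 1.
    move=> g0 ga; have : (g * L * n%:R) ^+ 2 <= (a * L * n%:R) ^+ 2.
      have h : g * L * n%:R <= a * L * n%:R by rewrite !ler_pM2r.
      by rewrite !expr2 ler_pM// !mulr_ge0// ltW.
    by rewrite aL exprVn r2; lra.
  have bound (g : R) : 0 < g -> g <= a -> gamma = g ->
      D ^+ 2 / (2 * g * n%:R * T%:R) + g ^+ 2 * L * n%:R * sigma ^+ 2 / 4
      <= rate L D sigma n%:R T%:R ->
      ('E_P[gap] <= (rate L D sigma n%:R T%:R)%:E)%E.
    move=> g0 ga gE h; rewrite /gap gE.
    have := expected_gap_le T_gt0 perms_uniform n_gt0 f_diff f_convex L_gt0
      f_smooth xs_min x0 g0 (small g g0 ga).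
    by move=> /le_trans; apply; rewrite lee_fin.
  have gammaE : gamma = if sigma == 0 then a else Num.min a
    ((D ^+ 2 / (L * n%:R ^+ 2 * T%:R * sigma ^+ 2)) `^ (1 / 3)) by [].
  (* Without noise the stepsize is [a] and only the first term of [rate] remains. *)
  have [sz|sn0] := eqVneq sigma 0.
    apply: (bound a) => //; first by rewrite gammaE sz eqxx.
    by rewrite sz expr0n mulr0 mul0r addr0 rate_large_step.
  move: gammaE; rewrite (negPf sn0) => gammaE.
  have sp : 0 < sigma by rewrite lt_neqAle eq_sym sn0.
  have [Dz|Dn0] := eqVneq D 0.
    (* Here the stepsize is 0, but x0 already is the minimizer. *)
    have g0 : gamma = 0.
      by rewrite gammaE Dz expr0n mul0r powR0 ?divr_neq0// min_r// ltW.
    have x0E : x0 = xs.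
      apply/eqP; rewrite -subr_eq0; apply/eqP/dot_eq0.
      by rewrite -enorm_sqr -/D Dz expr0n.
    have -> : gap = cst 0.
      apply/funext => w; rewrite /gap /average_iterate g0 /=.
      under eq_bigr do rewrite iterate_step0.
      rewrite sumr_const_nat subSS subn0 -[x0 *+ T]scaler_nat scalerA mulVf ?gt_eqF//.
      by rewrite scale1r x0E subrr.
    rewrite expectation_cst lee_fin /rate.
    by rewrite addr_ge0 ?divr_ge0 ?mulr_ge0 ?powR_ge0 ?sqrtr_ge0 ?sqr_ge0 ?ltW.
  have Dp : 0 < D by rewrite lt_neqAle eq_sym Dn0 enorm_ge0.
  have gp : 0 < gamma.
    rewrite gammaE lt_min a0 powR_gt0// divr_gt0 ?exprn_gt0//.
    by rewrite !mulr_gt0 ?exprn_gt0.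
  apply: (bound gamma) => //; first by rewrite gammaE ge_min lexx.
  exact: rate_step.
split; first exact: main.
move=> eps eps0 H; apply: le_trans main _; rewrite lee_fin.
by apply: rate_le_sqr => //; exact: enorm_ge0.
Qed.
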